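(* Let $A$ be a Banach algebra and let $a\in A$. Then $a$ has generalized Hirano inverse if and only if both of the following hold: (1) $a$ has g-Drazin inverse; (2) $a-a^3\in A^{qnil}$.
   Context: All Banach algebras are complex with identity $1$. For $a\in A$, $comm(a)=\{x\in A : xa=ax\}$, and $A^{qnil}=\{a\in A : 1+ax \text{ is invertible in } A \text{ for all } x\in comm(a)\}$ is the set of quasinilpotent elements. An element $a\in A$ has generalized Hirano inverse if there exists $b\in comm(a)$ with $b=bab$ and $a^2-ab\in A^{qnil}$. An element $a\in A$ has g-Drazin inverse if there exists $b\in comm(a)$ with $b=bab$ and $a-a^2b\in A^{qnil}$. *)

(* Defs.v *)
From HB Require Import structures.
From mathcomp Require Import all_boot all_order all_algebra complex.
From mathcomp Require Import all_classical all_reals all_analysis.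

Set Implicit Arguments.
Unset Strict Implicit.
Unset Printing Implicit Defensive.

Import Order.TTheory GRing.Theory Num.Theory.
Import numFieldNormedType.Exports.

Local Open Scope classical_set_scope.
Local Open Scope ring_scope.

(* A unital Banach algebra is a Banach space with an associative, unital,
   bilinear and submultiplicative product; the complex ones are those over
   K = R[i] with R : realType, the norm being valued in K.  The normalization
   `|1| = 1 is not required.
   The product is a field of the mixin, rather than inherited from algType K,
   because Num.NumDomain already joins the norm and ring structures without a
   common intermediate structure, so HB rejects the join of
   CompleteNormedModule and GRing.Algebra. The algType and unitAlgType
   structures are recovered below. *)
HB.mixin Record CompleteNormedModule_isBanachAlgebra (K : numFieldType) A
    & CompleteNormedModule K A := {
  banach_one : A;
  banach_mul : A -> A -> A;
  banach_mulA : associative banach_mul;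
  banach_mul1l : left_id banach_one banach_mul;
  banach_mul1r : right_id banach_one banach_mul;
  banach_mulDl : left_distributive banach_mul +%R;
  banach_mulDr : right_distributive banach_mul +%R;
  banach_scaleAl : forall (k : K) (x y : A),
    k *: banach_mul x y = banach_mul (k *: x) y;
  banach_scaleAr : forall (k : K) (x y : A),
    k *: banach_mul x y = banach_mul x (k *: y);
  banach_oner_neq0 : banach_one != 0;
  banach_normM : forall x y : A, `|banach_mul x y| <= `|x| * `|y|
}.

#[short(type="banachAlgType")]
HB.structure Definition BanachAlgebra (K : numFieldType) :=
  {A of CompleteNormedModule K A & CompleteNormedModule_isBanachAlgebra K A}.

Section BanachAlgebraRing.
Variables (K : numFieldType) (A : banachAlgType K).

#[non_forgetful_inheritance]
HB.instance Definition _ := GRing.Zmodule_isNzRing.Build A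
  (@banach_mulA K A) (@banach_mul1l K A) (@banach_mul1r K A)
  (@banach_mulDl K A) (@banach_mulDr K A) (@banach_oner_neq0 K A).

#[non_forgetful_inheritance]
HB.instance Definition _ :=
  GRing.Lmodule_isLalgebra.Build K A (@banach_scaleAl K A).

#[non_forgetful_inheritance]
HB.instance Definition _ :=
  GRing.Lalgebra_isAlgebra.Build K A (@banach_scaleAr K A).

Definition banach_unit : {pred A} :=
  fun x => `[< exists y : A, y * x = 1 /\ x * y = 1 >].

Definition banach_inv (x : A) : A :=
  if pselect (exists y : A, y * x = 1 /\ x * y = 1) is left ex_y
  then projT1 (cid ex_y) else x.

Let banach_mulVx : {in banach_unit, left_inverse 1 banach_inv *%R}.
Proof.
move=> x /asboolP ux; rewrite /banach_inv; case: pselect => // ex_y.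
by case: cid => y [].
Qed.

Let banach_mulxV : {in banach_unit, right_inverse 1 banach_inv *%R}.
Proof.
move=> x /asboolP ux; rewrite /banach_inv; case: pselect => // ex_y.
by case: cid => y [].
Qed.

Let banach_unitP (x y : A) : y * x = 1 /\ x * y = 1 -> banach_unit x.
Proof. by move=> xy1; apply/asboolP; exists y. Qed.

Let banach_inv_out : {in [predC banach_unit], banach_inv =1 id}.
Proof. by move=> x /asboolPn ux; rewrite /banach_inv; case: pselect. Qed.

#[non_forgetful_inheritance]
HB.instance Definition _ := GRing.NzRing_hasMulInverse.Build A
  banach_mulVx banach_mulxV banach_unitP banach_inv_out.

End BanachAlgebraRing.

Section GeneralizedInverses.
Variable A : unitRingType.

Definition commutant (a : A) : set A := [set x | GRing.comm x a].

Definition quasinilpotent : set A :=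
  [set a | forall x, commutant a x -> 1 + a * x \is a GRing.unit].

Definition has_generalized_Hirano_inverse (a : A) : Prop :=
  exists b, [/\ commutant a b, b = b * a * b &
    quasinilpotent (a ^+ 2 - a * b)].

Definition has_gDrazin_inverse (a : A) : Prop :=
  exists b, [/\ commutant a b, b = b * a * b &
    quasinilpotent (a - a ^+ 2 * b)].

End GeneralizedInverses.

(* Main.v *)
(* In a complex Banach algebra, a is quasinilpotent as soon as 1 + z a is
   invertible for every scalar z, because the spectral radius of a then
   vanishes.  Hence commuting sums and multiples of quasinilpotent elements are
   quasinilpotent, and the same b witnesses both generalized inverses of a:
   with x = a - a^2 b and w = a^2 - a b,
     x^2 = w (1 - a b),  a - a^3 = x - w a  and  w = x a - (a - a^3) b. *)
Require Import Defs.
From mathcomp Require Import all_boot all_order all_algebra complex.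
From mathcomp Require Import all_classical all_reals all_analysis.
From mathcomp Require Import lra.

Set Implicit Arguments.
Unset Strict Implicit.
Unset Printing Implicit Defensive.

Import Order.TTheory GRing.Theory Num.Theory.
Import numFieldNormedType.Exports.

Local Open Scope ring_scope.

(** * Geometric decay and the complex modulus *)

Lemma geometric_lt (R : realType) (C q e : R) : 0 <= q < 1 -> 0 < e ->
  exists n, C * q ^+ n < e.
Proof.
move=> /andP[q0 q1] e0.
have cvq : (geometric C q @ \oo --> (0 : R))%classic.
  by apply: cvg_geometric; rewrite ger0_norm.
have [n _ /(_ n (leqnn n)) /= Cn] := (cvgr0Pnorm_lt (geometric C q)).1 cvq e e0.
by exists n; rewrite (le_lt_trans _ Cn)//= ler_norm.
Qed.

Lemma normc_ge0 (R : rcfType) (z : R[i]) : 0 <= Normc.normc z.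
Proof. by case: z => x y; exact: sqrtr_ge0. Qed.

Lemma normc_real (R : rcfType) (r : R) : Normc.normc r%:C%C = `|r|.
Proof. by rewrite /= expr0n addr0 sqrtr_sqr. Qed.

(** * Norms as real numbers *)

Section RealNorm.
Variables (R : realType) (V : normedModType R[i]).
Implicit Types (x y : V) (z : R[i]).

(* The norm of V is valued in the partially ordered field R[i]. *)
Definition rnorm x : R := complex.Re `|x|.

Lemma rnormE x : `|x| = (rnorm x)%:C%C.
Proof. by rewrite /rnorm RRe_real // normr_real. Qed.

Lemma rnorm_ge0 x : 0 <= rnorm x.
Proof. by rewrite -ler0c -rnormE. Qed.

Lemma ler_rnormD x y : rnorm (x + y) <= rnorm x + rnorm y.
Proof. by rewrite -lecR rmorphD /= -!rnormE ler_normD. Qed.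

Lemma rnormN x : rnorm (- x) = rnorm x.
Proof. by rewrite /rnorm normrN. Qed.

Lemma rnormZ z x : rnorm (z *: x) = Normc.normc z * rnorm x.
Proof. by apply: complexI; rewrite -rnormE normrZ rmorphM rnormE. Qed.

Lemma rnorm_eq0 x : rnorm x = 0 -> x = 0.
Proof. by move=> x0; apply/normr0_eq0; rewrite rnormE x0. Qed.

Lemma ball_rnorm x (e : R) y : ball x e%:C%C y <-> rnorm (x - y) < e.
Proof. by rewrite -ball_normE /ball_ /= rnormE ltcR. Qed.

End RealNorm.

(** * Submultiplicativity and the Neumann series *)

Section BanachAlgebraNorm.
Variables (R : realType) (A : banachAlgType R[i]).
Implicit Types (x y v : A).

Lemma ler_rnormM x y : rnorm (x * y) <= rnorm x * rnorm y.
Proof. by rewrite -lecR rmorphM /= -!rnormE; exact: banach_normM. Qed.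

Lemma ler_rnormXM x y n : rnorm (x ^+ n * y) <= rnorm x ^+ n * rnorm y.
Proof.
elim: n => [|n IHn]; first by rewrite !expr0 !mul1r.
rewrite !exprS -!mulrA (le_trans (ler_rnormM _ _))//.
by rewrite ler_wpM2l ?rnorm_ge0.
Qed.

(** The partial sums [s n] of the geometric series are Cauchy, and their limit is a two-sided
    inverse. The norm of [1] may differ from 1, so it stays in the constants. *)
Lemma neumann x : rnorm x < 1 -> 1 - x \is a GRing.unit.
Proof.
set q := rnorm x => q1; have q0 : 0 <= q := rnorm_ge0 x.
pose s n : A := \sum_(i < n) x ^+ i.
have bnd n : (1 - q) * rnorm (s n) <= rnorm (1 : A).
  elim: n => [|n IHn].
    by rewrite /s big_ord0 /rnorm normr0 /= mulr0 rnorm_ge0.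
  have -> : s n.+1 = 1 + x * s n.
    rewrite /s big_ord_recl expr0 mulr_sumr; congr (_ + _).
    by apply: eq_bigr => i _; rewrite exprS.
  have := ler_rnormD (1 : A) (x * s n); have := ler_rnormM x (s n); rewrite -/q.
  have := rnorm_ge0 (1 : A); nra.
have tail n k : s (n + k)%N - s n = x ^+ n * s k.
  rewrite /s big_split_ord /= [X in X - _]addrC addrK mulr_sumr.
  by apply: eq_bigr => i _; rewrite exprD.
pose C := rnorm (1 : A) / (1 - q).
have bndC n : rnorm (s n) <= C.
  by rewrite /C ler_pdivlMr ?subr_gt0// mulrC bnd.
have cauchy_s n m : (n <= m)%N -> rnorm (s n - s m) <= C * q ^+ n.
  move=> nm; rewrite -rnormN opprB -(subnKC nm) tail.
  rewrite (le_trans (ler_rnormXM _ _ _))// mulrC ler_wpM2r ?exprn_ge0 //.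
have cvs : cvg (s n @[n --> \oo])%classic.
  apply/cauchy_cvgP/cauchy_exP => e e0.
  (* The radius [e] lives in [R[i]], where being positive forces it to be real. *)
  have e_re : e = (complex.Re e)%:C%C by rewrite RRe_real // gtr0_real.
  have [||n Cn] := @geometric_lt R C q (complex.Re e); first by rewrite q0.
    by rewrite -ltcR -e_re; exact: e0.
  exists (s n); exists n => // m /= nm.
  by rewrite e_re; apply/ball_rnorm; apply: le_lt_trans Cn; exact: cauchy_s.
pose l := lim (s n @[n --> \oo])%classic.
have close e : 0 < e -> exists n, rnorm (l - s n) < e /\ rnorm (x ^+ n) < e.
  move=> e0.
  have /cvg_ballP/(_ e%:C%C) : (s n @[n --> \oo] --> l)%classic by [].
  rewrite ltcR => /(_ e0) [n _ sn].
  have [||m qm] := @geometric_lt R (rnorm (1 : A)) q e; rewrite ?q0 //.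
  exists (n + m)%N; split; first by apply/ball_rnorm/sn/leq_addr.
  apply: le_lt_trans qm; rewrite -[x ^+ _]mulr1.
  rewrite (le_trans (ler_rnormXM _ _ _))// mulrC ler_wpM2l ?rnorm_ge0//.
  by rewrite exprD ler_piMl ?exprn_ge0// exprn_ile1 // ltW.
have sx n : (1 - x) * s n = 1 - x ^+ n.
  by rewrite -opprB -[1 - _ ^+ _]opprB subrX1 mulNr.
have xs n : s n * (1 - x) = 1 - x ^+ n.
  rewrite -sx; apply/commr_sym/commr_sum => i _; apply/commrX/commr_sym.
  by apply: commrB; [exact: commr1 | exact: commr_refl].
have small y : (forall n, rnorm y <=
    rnorm (1 - x) * rnorm (l - s n) + rnorm (x ^+ n)) -> y = 0.
  move=> ybnd; apply: rnorm_eq0; apply/eqP; rewrite eq_le rnorm_ge0 andbT.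
  apply/ler_addgt0Pr => e e0; rewrite add0r.
  (* The added 1 accounts for the term [rnorm (x ^+ n)]: two errors below [e / d] then total at most
     [d * (e / d) = e]. *)
  pose d := rnorm (1 - x) + 1.
  have d0 : 0 < d by rewrite ltr_wpDl ?rnorm_ge0.
  have [|n [ln xn]] := close (e / d); first by rewrite divr_gt0.
  apply: (le_trans (ybnd n)).
  rewrite -[leRHS](divfK (lt0r_neq0 d0)) {2}/d mulrDr mulr1 mulrC.
  by rewrite lerD ?ler_wpM2r ?rnorm_ge0// ltW.
apply/unitrP; exists l; split; apply/subr0_eq/small => n.
- have -> : l * (1 - x) - 1 = (l - s n) * (1 - x) - x ^+ n.
    by rewrite mulrBl xs opprB addrA addrAC addrK.
  by rewrite (le_trans (ler_rnormD _ _))// rnormN lerD2r mulrC ler_rnormM.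
- have -> : (1 - x) * l - 1 = (1 - x) * (l - s n) - x ^+ n.
    by rewrite mulrBr sx opprB addrA addrAC addrK.
  by rewrite (le_trans (ler_rnormD _ _))// rnormN lerD2r ler_rnormM.
Qed.

End BanachAlgebraNorm.

(** Smallness passes both ways: the first identity bounds [d] when [y] is small, the second bounds
    [y] when [d] is small. *)
Lemma inv1BB1 (A : unitRingType) (y : A) : 1 - y \is a GRing.unit ->
  let d := (1 - y)^-1 - 1 in d = y + y * d /\ y = d - d * y.
Proof.
move=> yu d; have dE : d = (1 - y)^-1 - 1 by [].
have yd : y * (1 - y)^-1 = d by rewrite -{1}(subKr 1 y) mulrBl divrr // mul1r.
have dy : (1 - y)^-1 * y = d by rewrite -{2}(subKr 1 y) mulrBr mulVr // mulr1.
split; first by rewrite {2}dE mulrBr yd mulr1 addrC subrK.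
by rewrite {2}dE mulrBl dy mul1r subKr.
Qed.

(** * Vanishing spectral radius, through resolvents of dyadic powers *)

Section Gelfand.
Variables (R : realType) (A : banachAlgType R[i]) (v : A).
Hypothesis unit_v : forall z : R[i], 1 - z *: v \is a GRing.unit.
Implicit Types (z : R[i]) (n : nat).

Local Notation normc := Normc.normc.

(** For nonzero [z] this is [z^-1] times the resolvent of [v ^+ (2 ^ n)] at [z^-1]; this form also
    covers [z = 0]. *)
Definition dyadic_resolvent n z : A := (1 - z *: v ^+ (2 ^ n))^-1.
Local Notation T := dyadic_resolvent.

Lemma dyadic_factor n z :
  1 - z ^+ 2 *: v ^+ (2 ^ n.+1) =
  (1 - z *: v ^+ (2 ^ n)) * (1 - (- z) *: v ^+ (2 ^ n)).
Proof.
rewrite scaleNr opprK mulrDr mulr1 mulrBl mul1r addrA subrK.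
by rewrite -scalerAl -scalerAr scalerA -!expr2 -exprM -expnSr.
Qed.

(** Every complex number is a square, so [dyadic_factor] reduces level [n.+1] to level [n]. *)
Lemma dyadic_unit n z : 1 - z *: v ^+ (2 ^ n) \is a GRing.unit.
Proof.
elim: n z => [|n IHn] z; first by rewrite expn0 expr1.
by rewrite -(sqr_sqrtc z) dyadic_factor unitrMl IHn.
Qed.

(* Replaces the average over n-th roots of unity in the usual proof of the
   spectral radius formula: estimates on T 0 that hold on discs pass to every
   T n, with the radius raised to the power 2 ^ n. *)
Lemma dyadic_resolvent_sqr n z :
  T n.+1 (z ^+ 2) = 2^-1 *: (T n z + T n (- z)).
Proof.
rewrite /T dyadic_factor invrM ?dyadic_unit //.
set p := 1 - _; set m := 1 - _.
have pm : p + m = 2%:A.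
  by rewrite /p /m scaleNr opprK addrACA subrr addr0 scaler_nat mulr2n.
have pu : p \is a GRing.unit by exact: dyadic_unit.
have mu : m \is a GRing.unit by exact: dyadic_unit.
have -> : m^-1 + p^-1 = p^-1 * (p + m) * m^-1.
  by rewrite mulrDr mulrDl mulVr // mul1r mulrK.
by rewrite pm -scalerAr mulr1 -scalerAl scalerA mulVf ?scale1r ?pnatr_eq0.
Qed.

Lemma resolvent_sub z w : T 0 z - T 0 w = (z - w) *: (T 0 z * v * T 0 w).
Proof.
rewrite /T expn0 expr1.
rewrite scalerAl scalerAr.
have -> : (z - w) *: v = (1 - w *: v) - (1 - z *: v).
  by rewrite scalerBl opprB [RHS]addrC addrA subrK.
by rewrite mulrBr mulVr // mulrBl mul1r mulrK.
Qed.

(** By the resolvent identity, [T 0 w - T 0 z] has norm at most [normc (w - z) * N * rnorm (T 0 w)].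
    The radius makes the coefficient of [rnorm (T 0 w)] at most 1/2, so this term is absorbed. *)
Lemma resolvent_locally_bounded z : exists2 e : R, 0 < e &
  forall w, normc (w - z) <= e -> rnorm (T 0 w) <= 2 * rnorm (T 0 z).
Proof.
pose N := rnorm v * rnorm (T 0 z).
have N0 : 0 <= N by rewrite mulr_ge0 ?rnorm_ge0.
exists (2 * (N + 1))^-1 => [|w wz].
  by rewrite invr_gt0 mulr_gt0// ltr_wpDl.
have : rnorm (T 0 w - T 0 z) <= 2^-1 * rnorm (T 0 w).
  rewrite resolvent_sub rnormZ -mulrA.
  have : rnorm (T 0 w * (v * T 0 z)) <= rnorm (T 0 w) * N.
    rewrite (le_trans (ler_rnormM _ _))// ler_wpM2l ?rnorm_ge0 //.
    exact: ler_rnormM.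
  have w0 : 0 <= normc (w - z) := normc_ge0 _.
  have wN : normc (w - z) * N <= 2^-1.
    have : normc (w - z) * (2 * (N + 1)) <= 1.
      by rewrite -ler_pdivlMr ?mul1r // mulr_gt0// ltr_wpDl.
    nra.
  have := rnorm_ge0 (T 0 w); set x := rnorm (T 0 w) => x0 H.
  have : normc (w - z) * rnorm (T 0 w * (v * T 0 z)) <= normc (w - z) * (x * N).
    by rewrite ler_wpM2l.
  nra.
have := ler_rnormD (T 0 w - T 0 z) (T 0 z); rewrite subrK.
lra.
Qed.

Lemma normc_ge_ReIm z (rho : R) : normc z <= rho ->
  (`[- rho, rho]%classic `*` `[- rho, rho]%classic)%classic
  (complex.Re z, complex.Im z).
Proof.
case: z => x y /= zr; split; rewrite /= in_itv /= -ler_norml;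
  by rewrite (le_trans _ zr)// -sqrtr_sqr ler_wsqrtr // (lerDl, lerDr) sqr_ge0.
Qed.

Lemma normc_le_ReIm (x y : R) : normc (Complex x y) <= `|x| + `|y|.
Proof.
rewrite /= -[leRHS]ger0_norm ?addr_ge0 // -sqrtr_sqr ler_wsqrtr //.
rewrite -(real_normK (num_real x)) -(real_normK (num_real y)).
have := normr_ge0 x; have := normr_ge0 y; nra.
Qed.

Lemma resolvent_bounded (rho : R) :
  exists M : R, forall z, normc z <= rho -> rnorm (T 0 z) <= M.
Proof.
have /compact_near_coveringP cK :=
  compact_setX (@segment_compact R (- rho) rho)
               (@segment_compact R (- rho) rho).
(* Compactness of the square around the disc, with the bound [M] as a parameter tending to infinity:
   near each point every large enough [M] works. *)
have [|M [Mr MP]] := cK R +oo%R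
  (fun M p => rnorm (T 0 (Complex p.1 p.2)) <= M) _.
  move=> [x y] _ /=.
  have [e e0 He] := resolvent_locally_bounded (Complex x y).
  exists (ball (x, y) (e / 2),
          [set M | 2 * rnorm (T 0 (Complex x y)) < M]%classic).
    split; first by apply: nbhsx_ballx; rewrite divr_gt0.
    by apply: nbhs_pinfty_gt; rewrite num_real.
  move=> [[x' y'] M] [[/= bx by'] /= ltM].
  apply: le_trans (ltW ltM); apply: He.
  have -> : Complex x' y' - Complex x y = Complex (x' - x) (y' - y) by [].
  rewrite (le_trans (normc_le_ReIm _ _))//.
  move: bx by'; rewrite /ball /= distrC [`|y - y'|]distrC; lra.
(* [MP] only covers bounds strictly above [M]. *)
exists (M + 1) => z /normc_ge_ReIm zr.
have := MP (M + 1); rewrite ltrDl ltr01 => /(_ isT) /(_ _ zr) /=.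
by case: z {zr}.
Qed.

(** Scaling is compatible with squaring, so the difference at level [n.+1] is the average of two
    differences at level [n], taken at the square roots of [z]; the error [e] does not grow. *)
Lemma dyadic_resolvent_radial (rho e r : R) : 0 <= rho ->
  (forall z, normc z <= rho -> rnorm (T 0 (r%:C%C * z) - T 0 z) <= e) ->
  forall n z, normc z <= rho ^+ (2 ^ n) ->
    rnorm (T n ((r ^+ (2 ^ n))%:C%C * z) - T n z) <= e.
Proof.
move=> rho0 H0; elim=> [|n IHn] z; first by rewrite expn0 !expr1; exact: H0.
rewrite -(sqr_sqrtc z) expnSr !exprM; set s := sqrtc z => zr.
have normsX : normc (s ^+ 2) = normc s ^+ 2 by rewrite !expr2 Normc.normcM.
have sr : normc s <= rho ^+ (2 ^ n).
  by move: zr; rewrite normsX ler_pXn2r // nnegrE ?exprn_ge0// normc_ge0.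
rewrite rmorphXn /= -exprMn !dyadic_resolvent_sqr -scalerBr rnormZ.
rewrite -mulrN opprD addrACA.
have nh : normc (2^-1 : R[i]) = 2^-1.
  apply: complexI; rewrite -[LHS]/(`|2^-1 : R[i]|) normfV normr_nat.
  by rewrite fmorphV rmorph_nat.
have := ler_rnormD (T n ((r ^+ (2 ^ n))%:C%C * s) - T n s)
  (T n ((r ^+ (2 ^ n))%:C%C * - s) - T n (- s)).
have := IHn s sr; have := IHn (- s); rewrite normcN => /(_ sr).
rewrite nh; lra.
Qed.

(* Smallness at rho1 makes T n close to 1 at rho1 ^ (2 ^ n), the radial estimate
   carries this over to rho2 ^ (2 ^ n), and there it forces the power of v to be
   small again. *)
Lemma dyadic_power_small_step (rho1 rho2 : R) :
  0 <= rho1 <= rho2 ->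
  (forall z, normc z <= rho2 ->
     rnorm (T 0 ((rho1 / rho2)%:C%C * z) - T 0 z) <= 8^-1) ->
  (exists n, rho1 ^+ (2 ^ n) * rnorm (v ^+ (2 ^ n)) <= 3^-1) ->
  exists n, rho2 ^+ (2 ^ n) * rnorm (v ^+ (2 ^ n)) <= 3^-1.
Proof.
move=> /andP[rho1_ge0 rho12] radial [n small].
have rho2_ge0 := le_trans rho1_ge0 rho12.
have [->|rho2_neq0] := eqVneq rho2 0.
  by exists 0%N; rewrite expn0 expr1 mul0r invr_ge0.
pose y1 := (rho1 ^+ (2 ^ n.+1))%:C%C *: v ^+ (2 ^ n.+1).
pose y2 := (rho2 ^+ (2 ^ n.+1))%:C%C *: v ^+ (2 ^ n.+1).
(* The constants close up: squaring turns 1/3 into 1/9; [d1] is then at most (1/9)/(1 - 1/9) = 1/8;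
   the radial estimate adds 1/8, so [d2] is at most 1/4; finally [y2] is at most (1/4)/(1 - 1/4) =
   1/3. *)
have y1_small : rnorm y1 <= 9^-1.
  rewrite rnormZ normc_real ger0_norm ?exprn_ge0 // expnSr !exprM !expr2.
  set p := rho1 ^+ _ in small *; set u := v ^+ _ in small *.
  have p0 : 0 <= p by exact: exprn_ge0.
  have px0 : 0 <= p * rnorm u by rewrite mulr_ge0 ?rnorm_ge0.
  apply: (@le_trans _ _ (p * rnorm u * (p * rnorm u))); last by nra.
  by rewrite mulrACA ler_wpM2l ?mulr_ge0 ?ler_rnormM.
pose d1 := T n.+1 (rho1 ^+ (2 ^ n.+1))%:C%C - 1.
pose d2 := T n.+1 (rho2 ^+ (2 ^ n.+1))%:C%C - 1.
have d1_small : rnorm d1 <= 8^-1.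
  have [d1E _] := inv1BB1 (dyadic_unit n.+1 (rho1 ^+ (2 ^ n.+1))%:C%C).
  have := ler_rnormD y1 (y1 * d1); rewrite -[y1 + _]d1E.
  have := ler_rnormM y1 d1; have := rnorm_ge0 d1; nra.
have d21 : rnorm (d1 - d2) <= 8^-1.
  rewrite /d1 /d2 opprB addrA subrK.
  have := dyadic_resolvent_radial rho2_ge0 radial (n := n.+1)
    (z := (rho2 ^+ (2 ^ n.+1))%:C%C).
  rewrite normc_real ger0_norm ?exprn_ge0 // lexx => /(_ isT).
  by rewrite -rmorphM /= -exprMn divfK.
have d2_small : rnorm d2 <= 4^-1.
  have := ler_rnormD d1 (- (d1 - d2)); rewrite rnormN opprB addrC subrK; lra.
exists n.+1.
have -> : rho2 ^+ (2 ^ n.+1) * rnorm (v ^+ (2 ^ n.+1)) = rnorm y2.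
  by rewrite rnormZ normc_real ger0_norm ?exprn_ge0.
have [_ y2E] := inv1BB1 (dyadic_unit n.+1 (rho2 ^+ (2 ^ n.+1))%:C%C).
have := ler_rnormD d2 (- (d2 * y2)); rewrite rnormN -[d2 - _]y2E.
have := ler_rnormM d2 y2; have := rnorm_ge0 y2; nra.
Qed.

(* The spectral radius of v is 0, reached from radius 0 to rho in N equal steps,
   each short enough for the Lipschitz constant L of the resolvent. *)
Lemma gelfand_dyadic (rho : R) : 0 <= rho ->
  exists n, rho ^+ (2 ^ n) * rnorm (v ^+ (2 ^ n)) <= 3^-1.
Proof.
rewrite le_eqVlt => /predU1P[<-|rho_gt0].
  by exists 0%N; rewrite expn0 expr1 mul0r invr_ge0.
have [M HM] := resolvent_bounded rho.
pose L := M * rnorm v * M.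
have M0 : 0 <= M.
  have : normc (0 : R[i]) <= rho by rewrite Normc.normc0 ltW.
  by move/HM; apply: le_trans; exact: rnorm_ge0.
have L0 : 0 <= L by rewrite !mulr_ge0 ?rnorm_ge0.
(* Chosen so that [rho / N%:R * L] is at most 1/8, the tolerance of [dyadic_power_small_step]. *)
pose N := (Num.trunc (8 * rho * L)).+1.
have NL : 8 * rho * L <= N%:R by rewrite ltW // truncnS_gt.
have N0 : 0 < N%:R :> R by rewrite ltr0n.
suff H k : (k <= N)%N ->
    exists n, (k%:R * (rho / N%:R)) ^+ (2 ^ n) * rnorm (v ^+ (2 ^ n)) <= 3^-1.
  by have := H N (leqnn N); rewrite mulrC divfK // gt_eqF.
set d := rho / N%:R; have d0 : 0 < d by rewrite divr_gt0.
elim: k => [|k IHk] kN; first by exists 0%N; rewrite mul0r expr1 mul0r invr_ge0.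
apply: dyadic_power_small_step (IHk (ltnW kN)).
  by rewrite mulr_ge0 ?(ltW d0) //= ler_wpM2r ?(ltW d0) // ler_nat.
have k0 : 0 < k.+1%:R :> R by rewrite ltr0n.
rewrite -mulf_div divff ?gt_eqF // mulr1.
(* Scaling [z] by the ratio [r] of consecutive radii moves it by at most
   [(1 - r) * (k.+1%:R * d) = d]. *)
set r := k%:R / k.+1%:R => z zd.
have rE : r * k.+1%:R = k%:R by rewrite divfK ?gt_eqF.
have r0 : 0 <= r by rewrite divr_ge0.
have rS : (1 - r) * k.+1%:R = 1 by rewrite mulrBl rE mul1r -natr1 addrC addKr.
have r1 : 0 <= 1 - r by rewrite subr_ge0 ler_pdivrMr // mul1r ler_nat.
have zrho : normc z <= rho.
  apply: le_trans zd _; rewrite /d mulrCA ler_piMr ?(ltW rho_gt0) //.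
  by rewrite ler_pdivrMr // mul1r ler_nat.
have rzrho : normc (r%:C%C * z) <= rho.
  rewrite Normc.normcM normc_real ger0_norm //.
  by rewrite (le_trans _ zrho)// ler_piMl ?normc_ge0// -subr_ge0.
have rz : normc (r%:C%C * z - z) <= d.
  rewrite -{2}[z]mul1r -mulrBl Normc.normcM -[1]/(1%:C%C) -rmorphB normc_real.
  rewrite distrC ger0_norm //.
  by rewrite (le_trans (ler_wpM2l r1 zd))// mulrA rS mul1r.
have TL : rnorm (T 0 (r%:C%C * z) * v * T 0 z) <= L.
  rewrite (le_trans (ler_rnormM _ _))// ler_pM ?rnorm_ge0 ?HM //.
  by rewrite (le_trans (ler_rnormM _ _))// ler_wpM2r ?rnorm_ge0 ?HM.
rewrite resolvent_sub rnormZ.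
rewrite (le_trans (ler_pM (normc_ge0 _) (rnorm_ge0 _) rz TL))//.
by rewrite /d mulrAC ler_pdivrMr // -ler_pdivrMl // invrK mulrA.
Qed.

(** With [rho = rnorm y], some power [u ^+ (2 ^ n)] of [u = - (v * y)] has norm at most 1/3, so
    [1 - u ^+ (2 ^ n)] is a unit by [neumann]; [1 - u] divides it with a commuting cofactor. *)
Lemma unit_1D_comm y : GRing.comm y v -> 1 + v * y \is a GRing.unit.
Proof.
move=> yv; have [n small] := gelfand_dyadic (rnorm_ge0 y).
set u := - (v * y); have -> : 1 + v * y = 1 - u by rewrite opprK.
have un : rnorm (u ^+ (2 ^ n)) < 1.
  suff : rnorm (u ^+ (2 ^ n)) <= 3^-1 by lra.
  apply: le_trans small; rewrite exprNn exprMn_comm; last exact: commr_sym.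
  rewrite -signr_odd mulr_sign [X in if _ then X else _]/(- _).
  rewrite (fun_if (@rnorm R A)) rnormN if_same mulrC.
  rewrite (le_trans (ler_rnormM _ _))// ler_wpM2l ?rnorm_ge0 //.
  (* Splitting off one factor [y] lets [ler_rnormXM] apply without the norm of [1] appearing. *)
  rewrite -(prednK (expn_gt0 2 n)) 2!exprSr.
  exact: ler_rnormXM.
have := neumann un.
rewrite -opprB subrX1 -mulNr opprB unitrM_comm => [/andP[]//|].
apply/commr_sum => i _; apply/commrX/commr_sym/commrB; first exact: commr1.
exact: commr_refl.
Qed.

End Gelfand.

(** * Closure properties of quasinilpotent elements *)

Section Quasinilpotent.
Variables (R : realType) (A : banachAlgType R[i]).
Implicit Types (a u w x y : A).

(** What commutes with a sum or product need not commute with its terms; testing on scalars only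
    removes this obstacle in the closure lemmas. *)
Lemma quasinilpotentP a :
  quasinilpotent a <-> forall z : R[i], 1 + z *: a \is a GRing.unit.
Proof.
split=> [qa z|ua y yx].
  have := qa z%:A; rewrite -scalerAr mulr1; apply.
  by rewrite /commutant /= /GRing.comm -scalerAl -scalerAr mul1r mulr1.
by apply: unit_1D_comm => // z; rewrite -scaleNr; exact: ua.
Qed.

Lemma quasinilpotentM u x :
  GRing.comm x u -> quasinilpotent u -> quasinilpotent (u * x).
Proof.
move=> xu qu; apply/quasinilpotentP => z; rewrite scalerAr; apply: qu.
by rewrite /commutant /= /GRing.comm -scalerAl -scalerAr xu.
Qed.

Lemma quasinilpotentN u : quasinilpotent u -> quasinilpotent (- u).
Proof.
move=> /quasinilpotentP qu; apply/quasinilpotentP => z.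
by rewrite scalerN -scaleNr.
Qed.

(** The unit [p = 1 + z *: u] commutes with [w] and factors out of [1 + z *: (u + w)], leaving
    [1 + w * (z *: p^-1)]. *)
Lemma quasinilpotentD u w : GRing.comm u w ->
  quasinilpotent u -> quasinilpotent w -> quasinilpotent (u + w).
Proof.
move=> uw /quasinilpotentP qu qw; apply/quasinilpotentP => z.
set p := 1 + z *: u; have pu : p \is a GRing.unit by exact: qu.
have wp : GRing.comm w p.
  apply: commrD; first exact: commr1.
  by rewrite /GRing.comm -scalerAl -scalerAr uw.
have -> : 1 + z *: (u + w) = p * (1 + w * (z *: p^-1)).
  rewrite mulrDr mulr1 mulrA -wp -scalerAr mulrK //.
  by rewrite scalerDr addrA.
rewrite unitrMl //; apply: qw; rewrite /commutant /=.
by rewrite /GRing.comm -scalerAl -scalerAr (commrV wp).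
Qed.

(** Testing [u ^+ 2] on [- y ^+ 2] gives a difference of squares, whose commuting factors must both
    be units. *)
Lemma quasinilpotent_sqr u : quasinilpotent (u ^+ 2) -> quasinilpotent u.
Proof.
move=> qu y yu.
have : 1 + u ^+ 2 * - y ^+ 2 \is a GRing.unit.
  apply: qu; rewrite /commutant /=; apply/commr_sym/commrN/commrX/commr_sym.
  exact/commrX.
have -> : 1 + u ^+ 2 * - y ^+ 2 = (1 + u * y) * (1 - u * y).
  rewrite mulrN -exprMn_comm; last exact/commr_sym.
  by rewrite mulrDl mul1r mulrBr mulr1 addrA subrK expr2.
rewrite unitrM_comm => [/andP[]//|].
apply: commrB; first exact: commr1.
by apply/commr_sym/commrD; [exact: commr1 | exact: commr_refl].
Qed.

End Quasinilpotent.

Theorem theorem2p4 (R : realType) (A : banachAlgType R[i]) (a : A) :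
  has_generalized_Hirano_inverse a <->
  has_gDrazin_inverse a /\ quasinilpotent (a - a ^+ 3).
Proof.
split=> [[b [ba bab qw]]|[[b [ba bab qx]] qz]];
  have ab : GRing.comm a b := esym ba.
- pose e := a * b.
  have ae : GRing.comm a e by apply: commrM.
  have ee : e * e = e by rewrite /e {3}bab !mulrA.
  have xE : a - a ^+ 2 * b = a * (1 - e) by rewrite mulrBr mulr1 mulrA -expr2.
  rewrite /has_gDrazin_inverse; set w := a ^+ 2 - a * b in qw.
  have aw : GRing.comm a w by apply: commrB => //; exact/commrX.
  have ew : GRing.comm e w.
    by apply: commrB; [exact/commrX/commr_sym | exact: commr_refl].
  have comm_1e y : GRing.comm y e -> GRing.comm y (1 - e).
    by apply: commrB; exact: commr1.
  have qx : quasinilpotent (a - a ^+ 2 * b).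
    apply: quasinilpotent_sqr.
    (* Both sides equal [a ^+ 2 * (1 - e)], because the idempotent [e] is killed by [1 - e]. *)
    have -> : (a - a ^+ 2 * b) ^+ 2 = w * (1 - e).
      have ide : (1 - e) * (1 - e) = 1 - e.
        by rewrite [LHS]mulrBr mulr1 [_ * e]mulrBl mul1r ee subrr subr0.
      rewrite xE exprMn_comm; last exact: comm_1e.
      rewrite [(1 - e) ^+ 2]expr2 ide /w -/e [in RHS]mulrBl.
      by rewrite [e * _]mulrBr mulr1 ee subrr subr0.
    by apply: quasinilpotentM => //; exact/commr_sym/comm_1e/commr_sym.
  split; first by exists b.
  have -> : a - a ^+ 3 = (a - a ^+ 2 * b) + w * - a.
    rewrite mulrN /w mulrBl opprB addrA -[a * b * a]mulrA -ab mulrA -expr2.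
    by rewrite subrK exprSr.
  apply: quasinilpotentD => //.
    rewrite xE; apply/commr_sym/commrM.
      by apply/commr_sym/commrM => //; exact/commrN/commr_refl.
    apply/comm_1e/commr_sym/commrM => //.
    exact/commrN/commr_sym.
  by apply: quasinilpotentM => //; exact/commr_sym/commrN/commr_sym.
- have aa : GRing.comm a a by exact: commr_refl.
  have bb : GRing.comm b b by exact: commr_refl.
  have comm_x y : GRing.comm y a -> GRing.comm y b ->
      GRing.comm y (a - a ^+ 2 * b).
    by move=> ya yb; apply: commrB => //; apply: commrM => //; exact: commrX.
  have comm_z y : GRing.comm y a -> GRing.comm y (a - a ^+ 3).
    by move=> ya; apply: commrB => //; exact: commrX.
  have wE : a ^+ 2 - a * b = (a - a ^+ 2 * b) * a + (a - a ^+ 3) * - b.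
    rewrite mulrN !mulrBl opprB -expr2 -[_ * b * a]mulrA -ab mulrA -exprSr.
    by rewrite addrA subrK.
  exists b; split=> //; rewrite wE; apply: quasinilpotentD.
  + have comm_xa y : GRing.comm y a -> GRing.comm y b ->
        GRing.comm ((a - a ^+ 2 * b) * a) y.
      by move=> ya yb; apply/commr_sym/commrM => //; exact: comm_x.
    by apply: commrM; [exact/comm_z/comm_xa | exact/commrN/comm_xa].
  + by apply: quasinilpotentM => //; exact: comm_x.
  + apply: quasinilpotentM => //.
    by apply/commr_sym/commrN/commr_sym/comm_z.
Qed.
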